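(* For every integer $n \ge 3$, we have $\chi'_{st}(C_5 \,\square\, C_n) = 7$.
   Context: A star edge-coloring of a graph $G$ is a proper edge-coloring of $G$ in which there is no bichromatic path and no bichromatic cycle of length four (i.e., with four edges). The star chromatic index $\chi'_{st}(G)$ is the minimum number of colors in a star edge-coloring of $G$. $C_m$ denotes the cycle on $m$ vertices. $G \,\square\, H$ denotes the Cartesian product: vertex set $V(G)\times V(H)$, with $(u,v)(u',v')$ an edge iff either $uu'\in E(G)$ and $v=v'$, or $u=u'$ and $vv'\in E(H)$. *)

(* Defs.v *)
From HB Require Import structures.
From mathcomp Require Import all_boot.
From mathcomp Require Import boolp.

Set Implicit Arguments.
Unset Strict Implicit.
Unset Printing Implicit Defensive.

Record sgraph := SGraph {
  vertex :> finType;
  adj : rel vertex;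
  adj_sym : symmetric adj;
  adj_irrefl : irreflexive adj }.

Section Cycle.
Variable n : nat.

(* [ordS] is the successor modulo [n].  The conjunct [i != j] only matters for
   [n = 1], where it discards the loop. *)
Definition cycle_adj : rel 'I_n :=
  [rel i j | (i != j) && ((j == ordS i) || (i == ordS j))].

Lemma cycle_adj_sym : symmetric cycle_adj.
Proof. by move=> i j; rewrite /cycle_adj /= eq_sym orbC. Qed.

Lemma cycle_adj_irrefl : irreflexive cycle_adj.
Proof. by move=> i; rewrite /cycle_adj /= eqxx. Qed.

Definition cycle_graph := SGraph cycle_adj_sym cycle_adj_irrefl.
End Cycle.

Section CartesianProduct.
Variables G H : sgraph.

Definition cart_adj : rel (G * H) :=
  [rel x y | (adj x.1 y.1 && (x.2 == y.2)) || ((x.1 == y.1) && adj x.2 y.2)].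

Lemma cart_adj_sym : symmetric cart_adj.
Proof.
move=> x y; rewrite /cart_adj /=.
by rewrite (adj_sym x.1) (adj_sym x.2) (eq_sym x.1) (eq_sym x.2).
Qed.

Lemma cart_adj_irrefl : irreflexive cart_adj.
Proof. by move=> x; rewrite /cart_adj /= !adj_irrefl andbF. Qed.

Definition cart_prod := SGraph cart_adj_sym cart_adj_irrefl.
End CartesianProduct.

Section StarEdgeColoring.
Variable G : sgraph.
Implicit Types (c : {set G} -> nat) (k : nat).

Definition edges : {set {set G}} :=
  [set [set xy.1; xy.2] | xy in [set xy : G * G | adj xy.1 xy.2]].

(* The edges traversed by the walk [x :: p]. *)
Definition walk_edges (x : G) (p : seq G) : seq {set G} :=
  pairmap (fun u v => [set u; v]) x p.

(* Colorings are functions on all vertex sets, of which only the values on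
   [edges] are ever constrained. *)
Definition uses_colors k c := forall e, e \in edges -> c e < k.

Definition proper_edge_coloring c :=
  forall e f, e \in edges -> f \in edges -> e != f -> e :&: f != set0 ->
  c e != c f.

Definition bichromatic c (s : seq {set G}) := size (undup (map c s)) == 2.

Definition star_edge_coloring c :=
  [/\ proper_edge_coloring c,
      forall x p, path (@adj G) x p -> uniq (x :: p) -> size p = 4 ->
        ~~ bichromatic c (walk_edges x p)
    & forall x p, ucycle (@adj G) (x :: p) -> size (x :: p) = 4 ->
        ~~ bichromatic c (walk_edges x (rcons p x))].

Definition star_edge_colorable k :=
  exists c, uses_colors k c /\ star_edge_coloring c.

Lemma bichromaticPn c s e1 e2 e3 : {in edges &, injective c} ->
    {subset [:: e1; e2; e3] <= s} -> {subset [:: e1; e2; e3] <= edges} ->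
  uniq [:: e1; e2; e3] -> ~~ bichromatic c s.
Proof.
move=> c_inj sub_s sub_E u3; apply/eqP=> s2.
have: size (map c [:: e1; e2; e3]) <= size (undup (map c s)).
  apply: uniq_leq_size; first by rewrite map_inj_in_uniq // => e f /sub_E ? /sub_E; exact: c_inj.
  by move=> k /mapP[e /sub_s es ->]; rewrite mem_undup map_f.
by rewrite s2.
Qed.

Lemma adj_edges x y : adj x y -> [set x; y] \in edges.
Proof. by move=> xy; apply/imsetP; exists (x, y); rewrite ?inE. Qed.

Lemma uniq_walk3 (x y z t : G) : uniq [:: x; y; z; t] ->
  uniq [:: [set x; y]; [set y; z]; [set z; t]].
Proof.
rewrite /= !inE !negb_or => /and4P[/and3P[xy xz xt] /andP[yz yt] zt _].
rewrite !andbT -!andbA; apply/and3P; split; apply/eqP => /setP.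
- by move/(_ x); rewrite !inE eqxx (negPf xy) (negPf xz).
- by move/(_ x); rewrite !inE eqxx (negPf xz) (negPf xt).
- by move/(_ y); rewrite !inE eqxx (negPf yz) (negPf yt).
Qed.

Lemma star_edge_colorable_ex : exists k, `[< star_edge_colorable k >].
Proof.
pose c (e : {set G}) := index e (enum edges).
have c_inj : {in edges &, injective c}.
  move=> e f eE fE ef; rewrite -(@nth_index _ set0 e (enum edges)) ?mem_enum //.
  by rewrite -/(c e) ef nth_index ?mem_enum.
exists #|edges|; apply/asboolP; exists c; split.
  by move=> e eE; rewrite cardE index_mem mem_enum.
split.
- by move=> e f eE fE ef _; apply: contra ef => /eqP /c_inj ->.
- move=> x [|y [|z [|t [|u [|]]]]] //= /and5P[xy yz zt tu _] U _.
  apply: (bichromaticPn c_inj (e1 := [set x; y]) (e2 := [set y; z]) (e3 := [set z; t])).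
  + by move=> e; rewrite !inE => /or3P[]->; rewrite ?orbT.
  + by move=> e; rewrite !inE => /or3P[]/eqP->; exact: adj_edges.
  + apply: uniq_walk3; have := U; rewrite -[_ && _]/(uniq ([:: x; y; z; t] ++ [:: u])).
    by rewrite cat_uniq => /andP[].
- move=> x [|y [|z [|t [|]]]] //= /andP[/= /and5P[xy yz zt tx _] U] _.
  apply: (bichromaticPn c_inj (e1 := [set x; y]) (e2 := [set y; z]) (e3 := [set z; t])).
  + by move=> e; rewrite !inE => /or3P[]->; rewrite ?orbT.
  + by move=> e; rewrite !inE => /or3P[]/eqP->; exact: adj_edges.
  + exact: uniq_walk3.
Qed.

Definition star_chromatic_index : nat := ex_minn star_edge_colorable_ex.

End StarEdgeColoring.

(* Main.v *)
Require Import Defs.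
From HB Require Import structures.
From mathcomp Require Import all_boot.
From mathcomp Require Import boolp zify.

(**
An edge-coloring is a star edge-coloring iff it is proper and no non-backtracking
walk of four edges is colored [a b a b].  Such walks lift to the universal cover
[C_5 x Z] of the torus in the second direction, so a star edge-coloring of
[C_5 x C_n] is the same as an [n]-periodic one of [C_5 x Z].  With six colors,
already seven consecutive columns of [C_5 x Z] cannot be colored; this is checked
by a backtracking search that identifies colorings up to renaming the colors.
With seven colors, a coloring is spelled as a cyclic word of length [n] whose
letters are colorings of single columns.  Whether it is a star edge-coloring only
depends on the factors of length four of the word, and the letters below admit
enough factors to write valid words of every length [n >= 3].
*)

Set Implicit Arguments.
Unset Strict Implicit.
Unset Printing Implicit Defensive.

(** * Star edge-colorings and non-backtracking walks *)

(** When consecutive colors differ, only the alternating pattern uses exactly two colors; this turns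
    [bichromatic] into two equalities. *)
Lemma size_undup4_eq2 (a b c d : nat) : a != b -> b != c -> c != d ->
  (size (undup [:: a; b; c; d]) == 2) = (a == c) && (b == d).
Proof.
move=> ab bc cd; rewrite /= !inE (negPf ab) (negPf bc) (negPf cd) /=.
by have [eac|] := eqVneq a c; have [ebd|] := eqVneq b d; have [ead|] := eqVneq a d;
  subst; rewrite ?eqxx in ab bc cd *.
Qed.

(* A non-backtracking closed walk of four edges other than a 4-cycle contains a
   triangle, on which a proper coloring already uses three colors. *)
Lemma star_edge_coloringP (G : sgraph) (c : {set G} -> nat) :
  star_edge_coloring c <->
  (forall x y z, adj x y -> adj y z -> x != z ->
     c [set x; y] != c [set y; z]) /\
  (forall x0 x1 x2 x3 x4,
     adj x0 x1 -> adj x1 x2 -> adj x2 x3 -> adj x3 x4 ->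
     x0 != x2 -> x1 != x3 -> x2 != x4 ->
     ~~ ((c [set x0; x1] == c [set x2; x3]) &&
         (c [set x1; x2] == c [set x3; x4]))).
Proof.
have adjN (x y : G) : adj x y -> x != y.
  by apply: contraTneq => ->; rewrite adj_irrefl.
split=> [[prop pth cyc]|[prop walk]].
- have prop2 x y z : adj x y -> adj y z -> x != z ->
      c [set x; y] != c [set y; z].
    move=> xy yz xz; apply: prop; rewrite ?adj_edges //.
      apply/eqP => /setP/(_ x); rewrite !inE eqxx (negPf xz) orbF.
      by rewrite (negPf (adjN _ _ xy)).
    by apply/set0Pn; exists y; rewrite !inE eqxx orbT.
  split=> // x0 x1 x2 x3 x4 a01 a12 a23 a34 n02 n13 n24.
  have p0 := prop2 _ _ _ a01 a12 n02.
  have p1 := prop2 _ _ _ a12 a23 n13.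
  have p2 := prop2 _ _ _ a23 a34 n24.
  have [e03|n03] := eqVneq x0 x3.
    have n21 : x2 != x1 by rewrite eq_sym adjN.
    have a31 : adj x3 x1 by rewrite -e03.
    by have := prop2 _ _ _ a23 a31 n21; rewrite -e03 eq_sym => /negPf->.
  have [e14|n14] := eqVneq x1 x4.
    have n32 : x3 != x2 by rewrite eq_sym adjN.
    have a42 : adj x4 x2 by rewrite -e14.
    by have := prop2 _ _ _ a34 a42 n32; rewrite -e14 eq_sym => /negPf->; rewrite andbF.
  have U4 : uniq [:: x0; x1; x2; x3].
    by rewrite /= !inE !negb_or (adjN _ _ a01) (adjN _ _ a12) (adjN _ _ a23)
         n02 n03 n13.
  rewrite -size_undup4_eq2 //.
  (* The first four vertices are distinct by now, so the walk is a 4-cycle if it closes up and a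
     path otherwise. *)
  have [e04|n04] := eqVneq x0 x4.
    have := cyc x0 [:: x1; x2; x3]; rewrite /ucycle /ucycleb U4 /= e04.
    by rewrite -{1}e04 a01 a12 a23 a34; apply.
  have := pth x0 [:: x1; x2; x3; x4]; apply; rewrite //= ?a01 ?a12 ?a23 ?a34 //.
  move: U4; rewrite /= !inE !negb_or n04 n14 n24 (adjN _ _ a34) !andbT.
  by move=> /and3P[-> -> ->].
have bi x0 x1 x2 x3 x4 : adj x0 x1 -> adj x1 x2 -> adj x2 x3 -> adj x3 x4 ->
    x0 != x2 -> x1 != x3 -> x2 != x4 ->
    ~~ bichromatic c [:: [set x0; x1]; [set x1; x2]; [set x2; x3]; [set x3; x4]].
  move=> a01 a12 a23 a34 n02 n13 n24.
  by rewrite /bichromatic [map _ _]/= size_undup4_eq2 ?prop ?walk.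
split.
- have share u v w : adj u v -> adj u w -> [set u; v] != [set u; w] ->
      c [set u; v] != c [set u; w].
    move=> uv uw ne; rewrite [[set u; v]]setUC; apply: prop => //.
      by rewrite adj_sym.
    by apply: contraNneq ne => ->.
  move=> _ _ /imsetP[[x y] /[!inE]/= xy ->] /imsetP[[z t] /[!inE]/= zt ->].
  move=> ne /set0Pn[u]; rewrite !inE => /andP[/orP[] /eqP eu /orP[] /eqP ev];
    subst; move: ne.
  + exact: share.
  + by rewrite [[set z; _]]setUC; apply: share; rewrite // adj_sym.
  + by rewrite [[set x; _]]setUC; apply: share; rewrite // adj_sym.
  + rewrite [[set x; _]]setUC [[set z; _]]setUC.
    by apply: share; rewrite // adj_sym.
- move=> x [|y [|z [|t [|u [|]]]]] //= /and5P[xy yz zt tu _] U _.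
  apply: bi => //; move: U; rewrite !inE !negb_or.
  + by case/andP=> /and4P[].
  + by case/and3P=> _ /and3P[].
  + by case/and4P=> _ _ /andP[].
- move=> x [|y [|z [|t [|]]]] //= /andP[/= /and5P[xy yz zt tx _] U] _.
  apply: bi => //; move: U; rewrite !inE !negb_or.
  + by case/andP=> /and3P[].
  + by case/and3P=> _ /andP[].
  + by case/andP=> /and3P[_ xz _] _; rewrite eq_sym.
Qed.

(** * Strips of the cylinder *)

(* The vertex [(i, j)] of a strip is in row [i < 5] and column [j < m].  Edge
   [10 * j + i] joins [(i, j)] to [(i + 1, j)], and edge [10 * j + 5 + i] joins
   [(i, j)] to [(i, j + 1)]. *)
Definition nbrs (m : nat) (u : nat * nat) : seq (nat * nat) :=
  let: (i, j) := u in
  [:: (i.+1 %% 5, j); ((i + 4) %% 5, j)]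
    ++ (if j.+1 < m then [:: (i, j.+1)] else [::])
    ++ (if j is j'.+1 then [:: (i, j')] else [::]).

(** The non-backtracking continuations of a walk that arrives at [v] from [u]. *)
Definition others (m : nat) (u v : nat * nat) : seq (nat * nat) :=
  [seq w <- nbrs m v | w != u].

Definition num (u v : nat * nat) : nat :=
  if u.2 == v.2 then 10 * u.2 + (if v.1 == u.1.+1 %% 5 then u.1 else v.1)
  else 10 * minn u.2 v.2 + 5 + u.1.

Definition ends (e : nat) : (nat * nat) * (nat * nat) :=
  let j := e %/ 10 in let i := e %% 10 in
  if i < 5 then ((i, j), (i.+1 %% 5, j)) else ((i - 5, j), (i - 5, j.+1)).

Definition strip_adj (u v : nat * nat) : Prop :=
  [/\ u.1 < 5, v.1 < 5 &
    [\/ v = (u.1.+1 %% 5, u.2), u = (v.1.+1 %% 5, v.2),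
        v = (u.1, u.2.+1) | u = (v.1, v.2.+1)]].

Lemma strip_adj_sym u v : strip_adj u v -> strip_adj v u.
Proof.
case=> u5 v5 uv; split=> //.
by case: uv; [constructor 2|constructor 1|constructor 4|constructor 3].
Qed.

Lemma nbrs_strip_adj m u v : u.1 < 5 -> v \in nbrs m u -> strip_adj u v.
Proof.
case: u => i j /= i5; rewrite !(inE, mem_cat) => /or4P[/eqP->|/eqP->||].
- by split=> //; [rewrite ltn_mod | constructor 1].
- split=> //=; [by rewrite ltn_mod | constructor 2; congr pair; lia].
- by case: ifP => // _ /[!inE]/eqP->; split=> //; constructor 3.
- by case: j => // j /[!inE]/eqP->; split=> //; constructor 4.
Qed.

Lemma ends_num u v : strip_adj u v ->
  ends (num u v) = (u, v) \/ ends (num u v) = (v, u).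
Proof.
case: u v => i j [i' j'] [/= i5 i5' uv]; rewrite /ends /num /=.
have E k l : l < 10 -> (10 * k + l) %/ 10 = k /\ (10 * k + l) %% 10 = l by lia.
have [eq_j|ne_j] := eqVneq j j'.
  have [|->] := E j (if i' == i.+1 %% 5 then i else i'); first by case: ifP; lia.
  move=> ->; case: eqP => [ei|ni]; first by left; rewrite i5 -ei -eq_j.
  right; rewrite i5'; congr (_, _, (_, _)) => //.
  by case: uv => -[]; lia.
rewrite -addnA; have [|-> ->] := E (minn j j') (5 + i); first lia.
have -> : (5 + i < 5) = false by lia.
by case: uv => -[ei ej]; [lia|lia|left|right]; congr (_, _, (_, _)); lia.
Qed.

Lemma ends_strip_adj e : strip_adj (ends e).1 (ends e).2.
Proof.
rewrite /ends; case: ifP => e5; split=> //=; rewrite ?ltn_mod //; try lia.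
  by constructor 1.
by constructor 3.
Qed.

Lemma othersP m u v w : v.1 < 5 -> w \in others m u v -> strip_adj v w /\ u != w.
Proof.
by move=> v5; rewrite mem_filter eq_sym => /andP[-> /(nbrs_strip_adj v5)].
Qed.

(** * Exhaustive search on a strip *)

Inductive color := C0 | C1 | C2 | C3 | C4 | C5.

Definition color_eqb (a b : color) : bool :=
  match a, b with
  | C0, C0 | C1, C1 | C2, C2 | C3, C3 | C4, C4 | C5, C5 => true
  | _, _ => false
  end.

Lemma color_eqP : Equality.axiom color_eqb.
Proof. by case; case; constructor. Qed.

HB.instance Definition _ := hasDecEq.Build color color_eqP.

Definition colors : seq color := [:: C0; C1; C2; C3; C4; C5].

(* Tables with constant-time access in the kernel: an edge is addressed by its
   column and its position in the column. *)
Inductive digit := D0 | D1 | D2 | D3 | D4 | D5 | D6 | D7 | D8 | D9.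

Definition digit_eqb (a b : digit) : bool :=
  match a, b with
  | D0, D0 | D1, D1 | D2, D2 | D3, D3 | D4, D4
  | D5, D5 | D6, D6 | D7, D7 | D8, D8 | D9, D9 => true
  | _, _ => false
  end.

Inductive block (T : Type) := Block of T & T & T & T & T & T & T & T & T & T.

Definition block_get T (d : digit) (b : block T) : T :=
  let: Block x0 x1 x2 x3 x4 x5 x6 x7 x8 x9 := b in
  match d with
  | D0 => x0 | D1 => x1 | D2 => x2 | D3 => x3 | D4 => x4
  | D5 => x5 | D6 => x6 | D7 => x7 | D8 => x8 | D9 => x9
  end.

Definition block_set T (d : digit) (b : block T) (x : T) : block T :=
  let: Block x0 x1 x2 x3 x4 x5 x6 x7 x8 x9 := b in
  match d with
  | D0 => Block x x1 x2 x3 x4 x5 x6 x7 x8 x9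
  | D1 => Block x0 x x2 x3 x4 x5 x6 x7 x8 x9
  | D2 => Block x0 x1 x x3 x4 x5 x6 x7 x8 x9
  | D3 => Block x0 x1 x2 x x4 x5 x6 x7 x8 x9
  | D4 => Block x0 x1 x2 x3 x x5 x6 x7 x8 x9
  | D5 => Block x0 x1 x2 x3 x4 x x6 x7 x8 x9
  | D6 => Block x0 x1 x2 x3 x4 x5 x x7 x8 x9
  | D7 => Block x0 x1 x2 x3 x4 x5 x6 x x8 x9
  | D8 => Block x0 x1 x2 x3 x4 x5 x6 x7 x x9
  | D9 => Block x0 x1 x2 x3 x4 x5 x6 x7 x8 x
  end.

Definition block_const T (x : T) : block T := Block x x x x x x x x x x.

Inductive key := Key of digit & digit.

Definition table := block (block color).

Definition table_get (k : key) (t : table) : color :=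
  let: Key a b := k in block_get b (block_get a t).

Definition table_set (k : key) (t : table) (c : color) : table :=
  let: Key a b := k in block_set a t (block_set b (block_get a t) c).

Arguments table_get : simpl never.
Arguments table_set : simpl never.

Definition digit_of (n : nat) : digit :=
  nth D0 [:: D0; D1; D2; D3; D4; D5; D6; D7; D8; D9] n.

Definition key_of (e : nat) : key := Key (digit_of (e %/ 10)) (digit_of (e %% 10)).

(* The constraints that the smaller edges put on the color of [edge]: it differs
   from the colors of [adjacent], and for [(x, y, z)] in [walks], it differs from
   the color of [z] as soon as [x] and [y] have the same color. *)
Record row := Row {
  edge : key;
  adjacent : seq key;
  walks : seq (key * key * key) }.

Fixpoint uncolorable (rows : seq row) (t : table) (olds news : seq color) : bool :=
  if rows isn't r :: rows' then false else
  let forbid c s := [seq x <- s | ~~ color_eqb c x] in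
  let s0 := if news is c :: _ then c :: olds else olds in
  let s1 := foldl (fun s a => forbid (table_get a t) s) s0 (adjacent r) in
  let s2 := foldl (fun s w => let: (x, y, z) := w in
    if color_eqb (table_get x t) (table_get y t)
    then forbid (table_get z t) s else s) s1 (walks r) in
  all (fun c =>
    if news is c' :: news' then
      if color_eqb c c'
      then uncolorable rows' (table_set (edge r) t c) (c' :: olds) news'
      else uncolorable rows' (table_set (edge r) t c) olds news
    else uncolorable rows' (table_set (edge r) t c) olds news) s2.

(** * Constraints on an edge from smaller edges *)

Section Constraints.
Variable m : nat.

Definition orientations (e : nat) := [:: ends e; ((ends e).2, (ends e).1)].

Definition adjacent_of (e : nat) : seq nat :=
  [seq a <- flatten [seq [seq num uv.2 w | w <- others m uv.1 uv.2]
                    | uv <- orientations e] | a < e].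

(** The two families have [e] as first and as second edge of the walk; with both orientations of
    [e], reversal covers the third and fourth positions. The filter charges each constraint to the
    largest edge of its walk. *)
Definition walks_of (e : nat) : seq (nat * nat * nat) :=
  [seq w <- flatten [seq
      flatten [seq flatten [seq [seq (num uv.2 x2, num x3 x4, num x2 x3)
        | x4 <- others m x2 x3] | x3 <- others m uv.2 x2] | x2 <- others m uv.1 uv.2]
      ++ flatten [seq flatten [seq [seq (num x0 uv.1, num uv.2 x3, num x3 x4)
        | x4 <- others m uv.2 x3] | x3 <- others m uv.1 uv.2] | x0 <- others m uv.2 uv.1]
    | uv <- orientations e] | [&& w.1.1 < e, w.1.2 < e & w.2 < e]].

Definition row_of (e : nat) : row :=
  Row (key_of e) [seq key_of a | a <- adjacent_of e]
    [seq (key_of w.1.1, key_of w.1.2, key_of w.2) | w <- walks_of e].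
End Constraints.

Lemma block_get_set T (d d' : digit) (b : block T) (x : T) :
  block_get d (block_set d' b x) =
  if digit_eqb d d' then x else block_get d b.
Proof. by case: b; case: d; case: d'. Qed.

Lemma table_get_set e e' t c : e < 100 -> e' < 100 ->
  table_get (key_of e) (table_set (key_of e') t c) =
  if e == e' then c else table_get (key_of e) t.
Proof.
move=> le le'; rewrite /table_get /table_set /key_of !block_get_set.
have dE a b : a < 10 -> b < 10 -> digit_eqb (digit_of a) (digit_of b) = (a == b).
  move=> a10 b10; have /allP/(_ a)/[!mem_iota] : all (fun a => all (fun b =>
    digit_eqb (digit_of a) (digit_of b) == (a == b)) (iota 0 10)) (iota 0 10) by [].
  by move=> /(_ a10)/allP/(_ b)/[!mem_iota]/(_ b10)/eqP.
rewrite !dE ?ltn_divLR ?ltn_mod //.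
have -> : (e == e') = (e %/ 10 == e' %/ 10) && (e %% 10 == e' %% 10) by lia.
by case: eqP => [->|_] /=; rewrite ?block_get_set ?dE ?ltn_mod.
Qed.

Lemma mem_foldl_map (T U : eqType) W (h : U -> W) (F : seq T -> W -> seq T)
    (us : seq U) s x :
  (forall u s', u \in us -> x \in s' -> x \in F s' (h u)) -> x \in s ->
  x \in foldl F s [seq h u | u <- us].
Proof.
elim: us s => [//|u us IH] s xF xs /=; apply: IH.
  by move=> v s' vus; apply: xF; rewrite inE vus orbT.
by apply: xF; rewrite // inE eqxx.
Qed.

(** * Soundness of the search *)

Section Soundness.
Variable m : nat.

Definition legal (f : nat -> color) : Prop := forall e,
  (forall a, a \in adjacent_of m e -> f a <> f e) /\
  (forall x y z, (x, y, z) \in walks_of m e -> f x = f y -> f z <> f e).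

Lemma legal_comp f g : injective g -> legal f -> legal (g \o f).
Proof.
move=> g_inj fL e; have [fa fw] := fL e; split=> [a /fa ne /g_inj //|].
by move=> x y z /fw fxyz /= /g_inj /fxyz ne /g_inj.
Qed.

Definition swap (a b x : color) : color :=
  if x == a then b else if x == b then a else x.

Lemma swapK a b : involutive (swap a b).
Proof.
move=> x; rewrite /swap.
by have [->|xa] := eqVneq x a; have [xb|xb] := eqVneq x b;
  rewrite ?eqxx ?(negPf xa) ?(negPf xb) //; case: eqVneq => // ->.
Qed.

(* Colors that have not been used yet are interchangeable, so only the first
   of them has to be tried. *)
Lemma uncolorable_sound k e t olds news f : e + k <= 100 ->
  uncolorable [seq row_of m x | x <- iota e k] t olds news -> legal f ->
  (forall x, x < e -> table_get (key_of x) t = f x /\ f x \in olds) ->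
  uniq (olds ++ news) -> (forall c, c \in olds ++ news) -> False.
Proof.
elim: k e t olds news f => [//|k IH] e t olds news f le.
rewrite [map _ _]/= [uncolorable _ _ _ _]/=.
set s1 := (X in foldl _ X (map _ (walks_of _ _))).
set s0 := (X in foldl _ X _) in s1 *; set s2 := foldl _ s1 _.
(* The color of [e] in a legal coloring that agrees with the table survives both filters. *)
have step g : legal g -> g e \in s0 ->
    (forall x, x < e -> table_get (key_of x) t = g x /\ g x \in olds) -> g e \in s2.
  move=> gL ge0 gt; have [ga gw] := gL e.
  have ge1 : g e \in s1.
    apply: mem_foldl_map ge0 => a s aA gs; rewrite mem_filter gs andbT.
    have ae : a < e by move: aA; rewrite mem_filter => /andP[].
    by rewrite (gt a ae).1; apply/eqP; exact: ga.
  apply: mem_foldl_map ge1 => -[[x y] z] s wW gs /=.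
  have /and3P[/= xe ye ze] : [&& x < e, y < e & z < e].
    by move: wW; rewrite mem_filter => /andP[].
  rewrite (gt x xe).1 (gt y ye).1 (gt z ze).1.
  case: color_eqP => [exy|//]; rewrite mem_filter gs andbT.
  by apply/eqP; exact: gw wW exy.
have ext g x : (forall x, x < e -> table_get (key_of x) t = g x /\ g x \in olds) ->
    x < e.+1 -> table_get (key_of x) (table_set (key_of e) t (g e)) = g x.
  move=> gt xe; rewrite table_get_set; [|lia..].
  by case: eqP => [->//|ne]; apply: (gt x _).1; lia.
move=> + fL ft U full; have le' : e.+1 + k <= 100 by rewrite addSnnS.
have [fe|fe] := boolP (f e \in olds).
  have fe0 : f e \in s0 by rewrite /s0; case: (news) => // c s; rewrite inE fe orbT.
  move=> /allP/(_ _ (step f fL fe0 ft)).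
  have ft' x : x < e.+1 ->
      table_get (key_of x) (table_set (key_of e) t (f e)) = f x /\ f x \in olds.
    move=> xe; split; first exact: ext.
    by have [->//|ne] := eqVneq x e; apply: (ft x _).2; lia.
  case: news {s0 s1 s2 step fe0} U full => [|c news] U full.
    by move=> un; apply: (IH _ _ _ _ _ le' un fL ft').
  have -> : color_eqb (f e) c = false.
    apply/color_eqP => fec; move: U; rewrite cat_uniq => /and3P[_ /hasPn/(_ c)].
    by rewrite inE eqxx -fec fe => /(_ isT).
  by move=> un; apply: (IH _ _ _ _ _ le' un fL ft').
case: news @s0 @s1 @s2 step U full => [|c news] s0 s1 s2 step U full.
  by have := full (f e); rewrite cats0 (negPf fe).
pose g := swap c (f e) \o f.
have gL : legal g by apply: legal_comp fL; apply: inv_inj; exact: swapK.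
have co : c \notin olds.
  move: U; rewrite cat_uniq => /and3P[_ /hasPn/(_ c) + _].
  by rewrite inE eqxx => /(_ isT).
have ge : g e = c by rewrite /g /= /swap eqxx; case: eqP => [->|].
have gt x : x < e -> table_get (key_of x) t = g x /\ g x \in olds.
  move=> xe; have [tx xo] := ft x xe.
  have -> : g x = f x; last by [].
  rewrite /g /= /swap; case: eqP => [fxc|_]; first by rewrite -fxc xo in co.
  by case: eqP => [fxe|//]; rewrite -fxe xo in fe.
have ge0 : g e \in s0 by rewrite ge inE eqxx.
move=> /allP/(_ _ (step g gL ge0 gt)).
have -> : color_eqb (g e) c by apply/eqP.
move=> un; apply: (IH _ _ _ _ _ le' un gL).
- move=> x xe; split; first exact: ext.
  have [->|ne] := eqVneq x e; first by rewrite ge inE eqxx.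
  by rewrite inE (gt x _).2 ?orbT //; lia.
- by rewrite -[_ ++ _]/([:: c] ++ olds ++ news) uniq_catCA.
- by move=> c'; have := full c'; rewrite !(mem_cat, inE) orbCA orbA.
Qed.
End Soundness.

(** Seven columns carry 6 * 10 + 5 = 65 edges, since no edge leaves the last column to the right.
    The initial table is arbitrary: only entries already set are read. *)
Lemma strip_uncolorable :
  uncolorable [seq row_of 7 e | e <- iota 0 65]
    (block_const (block_const C0)) [::] colors.
Proof. vm_cast_no_check (erefl true). Qed.

(** * The torus *)

Section Torus.
Variable n : nat.
Notation torus := (cart_prod (cycle_graph 5) (cycle_graph n.+3)).
Implicit Types x y : torus.

Definition up x : torus := (ordS x.1, x.2).
Definition right x : torus := (x.1, ordS x.2).

Lemma ordS_neq k (i : 'I_k.+2) : ordS i != i.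
Proof.
rewrite -val_eqE /=; have := ltn_ord i; rewrite ltnS leq_eqVlt => /orP[/eqP->|ik].
  by rewrite modnn.
by rewrite modn_small //; lia.
Qed.

Lemma ordS2_neq k (i : 'I_k.+3) : ordS (ordS i) != i.
Proof.
rewrite -val_eqE /= -addn1 modnDml addn1.
have [ik|ik] := ltnP i.+2 k.+3; first by rewrite modn_small //; lia.
have lt_i := ltn_ord i; rewrite -(subnK ik) modnDr modn_small; lia.
Qed.

Lemma cycle_adjE k (i j : 'I_k.+3) :
  cycle_adj i j = (j == ordS i) || (i == ordS j).
Proof.
rewrite /cycle_adj /=; have [->|//] := eqVneq i j.
by rewrite eq_sym (negPf (ordS_neq _)).
Qed.

Lemma torus_adjP x y :
  adj x y <-> [\/ y = up x, x = up y, y = right x | x = right y].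
Proof.
case: x y => [i j] [i' j'].
have -> : @adj torus (i, j) (i', j') =
  cycle_adj i i' && (j == j') || (i == i') && cycle_adj j j' by [].
rewrite !cycle_adjE /up /right /=; split.
  case/orP=> /andP[].
    by move=> /orP[]/eqP-> /eqP->; [constructor 1|constructor 2].
  by move=> /eqP-> /orP[]/eqP->; [constructor 3|constructor 4].
by case=> -[-> ->]; rewrite !eqxx ?orbT.
Qed.

(* Column [j] of a strip is laid on column [b + j] of the torus. *)
Definition pt (b : nat) (u : nat * nat) : torus :=
  (inord u.1, inord ((b + u.2) %% n.+3)).

Lemma pt_up b i j : i < 5 -> pt b (i.+1 %% 5, j) = up (pt b (i, j)).
Proof.
move=> i5; congr pair; apply/val_inj => /=.
by rewrite !inordK // ltn_mod.
Qed.

Lemma pt_right b i j : pt b (i, j.+1) = right (pt b (i, j)).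
Proof.
congr pair; apply/val_inj => /=.
by rewrite !inordK ?ltn_mod // addnS -addn1 -(addn1 (_ %% _)) modnDml.
Qed.

Lemma pt_adj b u v : strip_adj u v -> adj (pt b u) (pt b v).
Proof.
case: u v => i j [i' j'] [/= i5 i5' uv]; apply/torus_adjP.
by case: uv => -[-> ->]; rewrite ?pt_up ?pt_right //;
  [constructor 1|constructor 2|constructor 3|constructor 4].
Qed.

(** The covering map identifies columns that agree modulo [n.+3], and columns at distance at most
    two agree modulo [n.+3] only if they are equal. *)
Lemma pt_inj b u v : u.1 < 5 -> v.1 < 5 -> u.2 <= v.2 + 2 -> v.2 <= u.2 + 2 ->
  pt b u = pt b v -> u = v.
Proof.
case: u v => i j [i' j'] /= i5 i5' jj' j'j [/(congr1 val) /=].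
rewrite !inordK // => -> /(congr1 val) /=; rewrite !inordK ?ltn_mod //.
move=> E; congr pair; apply/eqP.
wlog le_jj' : j j' jj' j'j E / j <= j'.
  by move=> W; have [/W|/ltnW/W] := leqP j j'; [|rewrite eq_sym]; apply.
have : n.+3 %| (b + j') - (b + j) by rewrite -eqn_mod_dvd ?leq_add2l // E.
rewrite subnDl /dvdn modn_small; lia.
Qed.

Lemma strip_adj2_pt_neq b u v w : strip_adj u v -> strip_adj v w -> u != w ->
  pt b u != pt b w.
Proof.
move=> [u5 v5 uv] [_ w5 vw]; apply: contraNneq => /pt_inj -> //.
  by case: u v w {u5 v5 w5} uv vw => ? ? [? ?] [? ?] [] [] ? ? [] [] /=; lia.
by case: u v w {u5 v5 w5} uv vw => ? ? [? ?] [? ?] [] [] ? ? [] [] /=; lia.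
Qed.
End Torus.

(** * Six colors do not suffice *)

Section LowerBound.
Variables (n : nat) (c : {set cart_prod (cycle_graph 5) (cycle_graph n.+3)} -> nat).
Hypotheses (c6 : uses_colors 6 c) (c_star : star_edge_coloring c).

Definition strip_color (e : nat) : color :=
  nth C0 colors (c [set pt n 0 (ends e).1; pt n 0 (ends e).2]).

Lemma strip_color_num u v : strip_adj u v ->
  strip_color (num u v) = nth C0 colors (c [set pt n 0 u; pt n 0 v]).
Proof. by move=> /ends_num[] E; rewrite /strip_color E //= setUC. Qed.

Lemma nth_colors_inj u v u' v' : strip_adj u v -> strip_adj u' v' ->
  nth C0 colors (c [set pt n 0 u; pt n 0 v]) =
  nth C0 colors (c [set pt n 0 u'; pt n 0 v']) ->
  c [set pt n 0 u; pt n 0 v] = c [set pt n 0 u'; pt n 0 v'].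
Proof.
move=> uv uv' /eqP; rewrite nth_uniq //; first by move/eqP.
- by apply: c6; apply/adj_edges/pt_adj.
- by apply: c6; apply/adj_edges/pt_adj.
Qed.

(** The strip may wrap around the torus and overlap itself. This is harmless because
    non-backtracking walks of the strip project to non-backtracking walks, which is all that the
    constraints involve. *)
Lemma strip_color_legal m : legal m strip_color.
Proof.
have [prop walk] := (star_edge_coloringP c).1 c_star.
have orientP uv e : uv \in orientations e ->
    strip_adj uv.1 uv.2 /\ strip_color e = strip_color (num uv.1 uv.2).
  rewrite !inE => /orP[]/eqP->; have A := ends_strip_adj e.
    by rewrite strip_color_num.
  have A' := strip_adj_sym A.
  by rewrite strip_color_num // /strip_color setUC.
move=> e; split=> [a|x y z]; rewrite mem_filter => /andP[_ /flatten_mapP[[u v]]].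
  move=> /orientP[/= uv ->] /mapP[w wO ->].
  have [vw uw] := othersP (let: And3 _ v5 _ := uv in v5) wO.
  rewrite !strip_color_num // => /(nth_colors_inj vw uv)/esym/eqP.
  apply/negP/prop; [exact: pt_adj | exact: pt_adj |].
  exact: strip_adj2_pt_neq uv vw uw.
move=> /orientP[/= uv ->]; have vu := strip_adj_sym uv.
rewrite mem_cat.
move=> /orP[] /flatten_mapP[p pO /flatten_mapP[q qO /mapP[r rO [-> -> ->]]]].
  have [vp up'] := othersP (let: And3 _ v5 _ := uv in v5) pO.
  have [pq vq] := othersP (let: And3 _ v5 _ := vp in v5) qO.
  have [qr pr] := othersP (let: And3 _ v5 _ := pq in v5) rO.
  rewrite !strip_color_num // => /(nth_colors_inj vp qr) E1 /(nth_colors_inj pq uv) E2.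
  have := @walk (pt n 0 u) (pt n 0 v) (pt n 0 p) (pt n 0 q) (pt n 0 r).
  rewrite E1 E2 !eqxx => W; apply: (elimN idP (W _ _ _ _ _ _ _)) => //; try exact: pt_adj.
  - exact: strip_adj2_pt_neq uv vp up'.
  - exact: strip_adj2_pt_neq vp pq vq.
  - exact: strip_adj2_pt_neq pq qr pr.
have [up' vp] := othersP (let: And3 _ v5 _ := vu in v5) pO.
have [vq uq] := othersP (let: And3 _ v5 _ := uv in v5) qO.
have [qr vr] := othersP (let: And3 _ v5 _ := vq in v5) rO.
have pu := strip_adj_sym up'.
rewrite !strip_color_num // => /(nth_colors_inj pu vq) E1 /(nth_colors_inj qr uv) E2.
have := @walk (pt n 0 p) (pt n 0 u) (pt n 0 v) (pt n 0 q) (pt n 0 r).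
rewrite E1 E2 !eqxx => W; apply: (elimN idP (W _ _ _ _ _ _ _)) => //; try exact: pt_adj.
- by apply: strip_adj2_pt_neq pu uv _; rewrite eq_sym.
- exact: strip_adj2_pt_neq uv vq uq.
- exact: strip_adj2_pt_neq vq qr vr.
Qed.
End LowerBound.

Lemma torus_not_star_edge_colorable6 n :
  ~ star_edge_colorable (cart_prod (cycle_graph 5) (cycle_graph n.+3)) 6.
Proof.
move=> [c [c6 c_star]].
apply: (uncolorable_sound _ strip_uncolorable (strip_color_legal c6 c_star 7)) => //.
by case.
Qed.

(** * Seven colors suffice *)

(* A letter lists the colors of the ten edges of a column, in the order of
   their numbers.  The letters fall into four independent systems, each found by
   a randomized backtracking search: 0-6 for the lengths [3 q] and [3 q + 7], 7-14
   for the lengths [3 q + 8], 15-18 for length 4 and 19-23 for length 5. *)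
Definition letters : seq (seq nat) := [::
  [:: 2; 5; 3; 5; 4; 0; 1; 4; 0; 1];
  [:: 2; 3; 6; 4; 5; 4; 5; 1; 2; 0];
  [:: 3; 4; 5; 3; 1; 6; 6; 0; 6; 2];
  [:: 0; 2; 3; 0; 4; 1; 5; 1; 1; 5];
  [:: 4; 2; 4; 6; 3; 5; 3; 6; 5; 2];
  [:: 2; 0; 2; 4; 1; 6; 5; 1; 3; 0];
  [:: 4; 0; 4; 5; 1; 3; 6; 2; 6; 2];
  [:: 4; 6; 3; 6; 1; 2; 0; 2; 4; 0];
  [:: 6; 4; 5; 3; 1; 4; 2; 1; 0; 6];
  [:: 0; 3; 6; 4; 3; 5; 1; 5; 2; 5];
  [:: 4; 0; 3; 1; 2; 0; 2; 2; 4; 6];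
  [:: 3; 6; 5; 3; 1; 2; 5; 1; 0; 0];
  [:: 1; 0; 6; 2; 5; 4; 3; 5; 4; 4];
  [:: 0; 6; 3; 1; 6; 1; 2; 4; 5; 3];
  [:: 3; 1; 0; 2; 0; 5; 5; 5; 1; 4];
  [:: 1; 0; 2; 5; 4; 3; 2; 3; 1; 2];
  [:: 5; 6; 4; 3; 0; 1; 3; 2; 6; 1];
  [:: 4; 1; 0; 5; 6; 2; 0; 5; 2; 4];
  [:: 3; 4; 6; 3; 1; 6; 5; 1; 4; 0];
  [:: 5; 3; 4; 0; 4; 3; 6; 1; 6; 1];
  [:: 0; 5; 3; 4; 2; 1; 3; 4; 2; 0];
  [:: 4; 2; 0; 3; 6; 5; 1; 5; 1; 5];
  [:: 3; 6; 0; 4; 2; 0; 5; 3; 6; 1];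
  [:: 4; 1; 4; 3; 5; 2; 0; 2; 5; 6]].

(** A transition graph. Letter 2 lies on cycles of lengths 3 and 7, letter 9 on cycles of lengths 3
    and 8; the last two systems are single cycles of lengths 4 and 5. *)
Definition next_letters : seq (seq nat) :=
  [:: [:: 1]; [:: 2]; [:: 0; 3]; [:: 4]; [:: 5]; [:: 6]; [:: 0];
      [:: 8]; [:: 9]; [:: 7; 10]; [:: 11]; [:: 12]; [:: 13]; [:: 14]; [:: 7];
      [:: 16]; [:: 17]; [:: 18]; [:: 15];
      [:: 20]; [:: 21]; [:: 22]; [:: 23]; [:: 19]].

Definition follows : rel nat :=
  [rel a b | (a < 24) && (b \in nth [::] next_letters a)].

Definition word (n : nat) : seq nat :=
  if n == 4 then iota 15 4
  else if n == 5 then iota 19 5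
  else if n %% 3 == 0 then flatten (nseq (n %/ 3) (iota 0 3))
  else if n %% 3 == 1 then
    iota 3 4 ++ iota 0 3 ++ flatten (nseq (n %/ 3 - 2) (iota 0 3))
  else iota 10 5 ++ iota 7 3 ++ flatten (nseq (n %/ 3 - 2) (iota 7 3)).

Lemma size_word n : 3 <= n -> size (word n) = n.
Proof.
have F k (s : seq nat) : size (flatten (nseq k s)) = k * size s.
  by rewrite size_flatten /shape map_nseq sumn_nseq mulnC.
move=> n3; rewrite /word; do ![case: eqP => ?];
  rewrite ?size_cat ?F ?size_iota; lia.
Qed.

Lemma path_flatten_nseq (T : Type) (e : rel T) x s k :
  last x s = x -> path e x s ->
  last x (flatten (nseq k s)) = x /\ path e x (flatten (nseq k s)).
Proof.
move=> lx xs; elim: k => [//|k [IHl IHp]]; rewrite [flatten _]/=.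
by rewrite last_cat cat_path lx xs.
Qed.

Lemma cycle_word n : cycle follows (word n).
Proof.
(* Closed walks [t] and [s] based at the same letter [x] can be concatenated; the base is 2 or 9
   below. *)
have C x s t k : last x s = x -> path follows x s -> last x t = x ->
    path follows x t -> cycle follows (t ++ flatten (nseq k s)).
  move=> lx xs lt xt; have [lk pk] := path_flatten_nseq k lx xs.
  by rewrite (cycle_path x) last_cat lt lk cat_path xt lt.
rewrite /word; do ![case: eqP => // ?].
- exact: (C 2 (iota 0 3) [::]).
- by rewrite catA; exact: (C 2).
- by rewrite catA; exact: (C 9).
Qed.

Lemma follows_word n j : 3 <= n -> j < n ->
  follows (nth 0 (word n) j) (nth 0 (word n) (j.+1 %% n)).
Proof.
move=> n3 jn; have := cycle_word n; have := size_word n3.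
case: (word n) => [|a s] /= sn; first lia.
move=> /(pathP 0)/(_ j); rewrite size_rcons sn => /(_ jn).
rewrite nth_rcons -rcons_cons nth_rcons /= sn jn => H.
have [jn'|] := ltnP j.+1 n; first by move: H; rewrite modn_small //= ifT //; lia.
move=> nj; have -> : j.+1 = n by lia.
by move: H; rewrite modnn ifF ?ifT //; lia.
Qed.

(* The walks of four edges centered in column [j] only use edges numbered in the
   columns [j - 2], ..., [j + 1], whose letters form the window. *)
Definition window_color (w : seq nat) (e : nat) : nat :=
  nth 0 (nth [::] letters (nth 0 w (e %/ 10))) (e %% 10).

Definition window_ok (w : seq nat) : bool :=
  let g u v := window_color w (num u v) in
  all (fun i => let x2 := (i, 2) in
    all (fun x1 => all (fun x3 =>
      (g x1 x2 != g x2 x3) &&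
      all (fun x0 => all (fun x4 =>
        ~~ ((g x0 x1 == g x2 x3) && (g x1 x2 == g x3 x4)))
        (others 5 x2 x3)) (others 5 x2 x1))
      (others 5 x1 x2)) (nbrs 5 x2)) (iota 0 5).

(** A finite check over all walks of four letters in the transition graph. *)
Lemma windows_ok a b c d : follows a b -> follows b c -> follows c d ->
  window_ok [:: a; b; c; d].
Proof.
move=> /andP[a24 ab] /andP[_ bc] /andP[_ cd].
have /allP/(_ a)/[!mem_iota]/(_ a24)/allP/(_ _ ab)/allP/(_ _ bc)/allP/(_ _ cd) //:
  all (fun a => all (fun b => all (fun c => all (fun d => window_ok [:: a; b; c; d])
    (nth [::] next_letters c)) (nth [::] next_letters b))
    (nth [::] next_letters a)) (iota 0 24).
by vm_compute.
Qed.

Lemma eq_set2 (T : finType) (a b c d : T) : [set a; b] = [set c; d] ->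
  a = c /\ b = d \/ a = d /\ b = c.
Proof.
move=> E.
have /set2P aE : a \in [set c; d] by rewrite -E set21.
have /set2P bE : b \in [set c; d] by rewrite -E set22.
have /set2P cE : c \in [set a; b] by rewrite E set21.
have /set2P dE : d \in [set a; b] by rewrite E set22.
by case: aE bE cE dE => ? [] ? [] ? [] ?; subst; auto.
Qed.

(** * The coloring of the torus spelled by a word *)

Section UpperBound.
Variable n : nat.
Notation torus := (cart_prod (cycle_graph 5) (cycle_graph n.+3)).

Definition letter_color (x : torus) (k : nat) : nat :=
  nth 0 (nth [::] letters (nth 0 (word n.+3) x.2)) k.

Definition edge_color (e : {set torus}) : nat :=
  if [pick x | e == [set x; up x]] is Some x then letter_color x x.1
  else if [pick x | e == [set x; right x]] is Some x then letter_color x (5 + x.1)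
  else 0.

(** The vertex picked is [x] itself: reading the edge from its other end would make two successor
    steps return to the start, impossible in a cycle of length at least three. *)
Lemma edge_color_up x : edge_color [set x; up x] = letter_color x x.1.
Proof.
rewrite /edge_color; case: pickP => [y /eqP/eq_set2[[->]//|[exy eyx]]|/(_ x)].
  by have /eqP := congr1 fst eyx; rewrite exy /= (negPf (ordS2_neq _)).
by rewrite eqxx.
Qed.

Lemma edge_color_right x : edge_color [set x; right x] = letter_color x (5 + x.1).
Proof.
rewrite /edge_color.
case: pickP => [y /eqP/eq_set2[[-> /(congr1 fst)]|[-> /(congr1 fst)]]|_].
- by move=> /esym/eqP; rewrite /= (negPf (ordS_neq _)).
- by move=> /eqP; rewrite /= (negPf (ordS_neq _)).
case: pickP => [y /eqP/eq_set2[[->]//|[exy eyx]]|/(_ x)].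
  by have /eqP := congr1 snd eyx; rewrite exy /= (negPf (ordS2_neq _)).
by rewrite eqxx.
Qed.

Definition window (b : nat) : seq nat :=
  mkseq (fun k => nth 0 (word n.+3) ((b + k) %% n.+3)) 4.

Lemma letter_color_pt b i j k : j < 4 -> k < 10 ->
  letter_color (pt n b (i, j)) k = window_color (window b) (10 * j + k).
Proof.
move=> j4 k10; rewrite /letter_color /window_color.
have [-> ->] : (10 * j + k) %/ 10 = j /\ (10 * j + k) %% 10 = k by lia.
by rewrite nth_mkseq //= inordK ?ltn_mod.
Qed.

Lemma edge_color_pt b u v : strip_adj u v -> minn u.2 v.2 < 4 ->
  edge_color [set pt n b u; pt n b v] = window_color (window b) (num u v).
Proof.
case: u v => i j [i' j'] [/= i5 i5' uv] j4; rewrite /num /=.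
case: uv => -[ei ej].
- rewrite ei ej !eqxx pt_up // edge_color_up letter_color_pt /= ?inordK //; lia.
- have -> : (i' == i.+1 %% 5) = false by lia.
  rewrite ei ej eqxx setUC pt_up // edge_color_up letter_color_pt /= ?inordK //; lia.
- have -> : (j == j') = false by lia.
  rewrite ei ej pt_right edge_color_right letter_color_pt /= ?inordK //; try lia.
  by congr window_color; lia.
- have -> : (j == j') = false by lia.
  rewrite ei ej setUC pt_right edge_color_right letter_color_pt /= ?inordK //; try lia.
  by congr window_color; lia.
Qed.

Lemma window_window_ok b : window_ok (window b).
Proof.
have F k : follows (nth 0 (word n.+3) (k %% n.+3)) (nth 0 (word n.+3) (k.+1 %% n.+3)).
  have := @follows_word n.+3 (k %% n.+3) isT; rewrite ltn_mod => /(_ isT).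
  by rewrite -[(k %% _).+1]addn1 modnDml addn1.
by apply: windows_ok; rewrite ?addnS; exact: F.
Qed.

Lemma letter_color_lt7 x k : letter_color x k < 7.
Proof.
rewrite /letter_color; move: (nth 0 (word _) _) => a.
have [la|la] := ltnP a (size letters); last by rewrite (nth_default [::] la) nth_nil.
have [lk|lk] := ltnP k (size (nth [::] letters a)); last by rewrite nth_default.
have /allP/(_ _ (mem_nth [::] la)) : all (all (fun c => c < 7)) letters by [].
by move=> /allP/(_ _ (mem_nth 0 lk)).
Qed.

Lemma torus_star_edge_colorable7 : star_edge_colorable torus 7.
Proof.
(* Modulo [n.+3] this is [x.2 - 2], which places [x] in the middle column 2 of its window. *)
pose base (x : torus) := x.2 + n.+1.
pose ctr (x : torus) : nat * nat := (val x.1, 2).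
have ptc x : pt n (base x) (ctr x) = x.
  case: x => i j; congr pair; apply/val_inj; rewrite /= !inordK ?ltn_mod //.
  by rewrite /base /= -addnA addn2 modnDr modn_small.
have up_inj : injective (@up n).
  move=> [i j] [i' j'] E; congr pair; last exact: (congr1 snd E).
  exact: ordS_inj (congr1 fst E).
have right_inj : injective (@right n).
  move=> [i j] [i' j'] E; congr pair; first exact: (congr1 fst E).
  exact: ordS_inj (congr1 snd E).
(* Neighbors lift to the strip from its interior columns 1 to 3, where the first and last steps out
   of the center also start. *)
have nbr b u y : u.1 < 5 -> 0 < u.2 -> u.2 < 4 -> adj (pt n b u) y ->
    exists2 v, v \in nbrs 5 u & y = pt n b v.
  case: u => i j /= i5 j0 j4 /torus_adjP[->|e|->|e].
  - by exists (i.+1 %% 5, j); rewrite ?pt_up // inE eqxx.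
  - exists ((i + 4) %% 5, j); first by rewrite !inE eqxx orbT.
    apply: up_inj; rewrite -e -pt_up ?ltn_mod //; congr (pt n b (_, _)); lia.
  - exists (i, j.+1); rewrite ?pt_right //.
    by rewrite !(inE, mem_cat) ltnS j4 !inE eqxx !orbT.
  - case: j j0 j4 e => // j _ j4 e; exists (i, j).
      by rewrite !(inE, mem_cat) eqxx !orbT.
    by apply: right_inj; rewrite -e -pt_right.
exists edge_color; split.
  move=> e _; rewrite /edge_color; case: pickP => [x _|_]; first exact: letter_color_lt7.
  by case: pickP => [x _|//]; exact: letter_color_lt7.
have inner u v : u.2 = 2 -> v \in nbrs 5 u -> 0 < v.2 < 4.
  by case: u => i j /= ->; rewrite !inE => /or4P[]/eqP->.
apply/star_edge_coloringP.
(* Both conditions are read around the middle vertex [y], so that one window contains the whole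
   walk. *)
have main x1 y x3 : adj x1 y -> adj y x3 -> x1 != x3 ->
    edge_color [set x1; y] != edge_color [set y; x3] /\
    forall x0 x4, adj x0 x1 -> adj x3 x4 -> x0 != y -> y != x4 ->
      ~~ ((edge_color [set x0; x1] == edge_color [set y; x3]) &&
          (edge_color [set x1; y] == edge_color [set x3; x4])).
  rewrite [adj x1 y]adj_sym; set b := base y; set u := ctr y.
  have u5 : u.1 < 5 by exact: ltn_ord.
  rewrite -(ptc y) -/b -/u => /nbr[]// u1 n1 -> /nbr[]// u3 n3 -> ne.
  have a1 := nbrs_strip_adj u5 n1; have a3 := nbrs_strip_adj u5 n3.
  have [_ v1 _] := a1; have [_ v3 _] := a3.
  have /andP[u1_gt0 u1_lt4] := inner u u1 erefl n1.
  have /andP[u3_gt0 u3_lt4] := inner u u3 erefl n3.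
  have n13 : u3 \in others 5 u1 u.
    by rewrite mem_filter n3 andbT; apply: contraNneq ne => ->.
  have := window_window_ok b.
  have u1I : val y.1 \in iota 0 5 by rewrite mem_iota ltn_ord.
  move=> /allP/(_ _ u1I)/allP/(_ u1 n1)/allP/(_ u3 n13)/andP[ok2 ok4].
  have E1 : edge_color [set pt n b u1; pt n b u] = window_color (window b) (num u1 u).
    by apply: edge_color_pt; [exact: strip_adj_sym | rewrite gtn_min u1_lt4].
  have E3 : edge_color [set pt n b u; pt n b u3] = window_color (window b) (num u u3).
    by apply: edge_color_pt; rewrite ?gtn_min ?u3_lt4 ?orbT.
  rewrite E1 E3.
  split=> // x0 x4; rewrite [adj x0 _]adj_sym.
  move=> /nbr[]// u0 n0 -> /nbr[]// u4 n4 -> n02 n24.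
  have n02' : u0 \in others 5 u u1.
    by rewrite mem_filter n0 andbT; apply: contraNneq n02 => ->.
  have n24' : u4 \in others 5 u u3.
    by rewrite mem_filter n4 andbT; apply: contraNneq n24 => ->.
  have a0 := strip_adj_sym (nbrs_strip_adj v1 n0); have a4 := nbrs_strip_adj v3 n4.
  rewrite !edge_color_pt ?gtn_min ?u1_lt4 ?u3_lt4 ?orbT //.
  by move: ok4 => /allP/(_ u0 n02')/allP/(_ u4 n24').
split=> [x y z xy yz xz|x0 x1 x2 x3 x4 a01 a12 a23 a34 n02 n13 n24].
  exact: (main _ _ _ xy yz xz).1.
exact: (main _ _ _ a12 a23 n13).2.
Qed.
End UpperBound.

Theorem theorem16 (n : nat) (hn : 3 <= n) :
  star_chromatic_index (cart_prod (cycle_graph 5) (cycle_graph n)) = 7.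
Proof.
case: n hn => [|[|[|n]]] // _.
rewrite /star_chromatic_index; case: ex_minnP => k /asboolP k_col k_min.
apply/eqP; rewrite eqn_leq k_min /=; last first.
  exact/asboolP/torus_star_edge_colorable7.
(* A coloring with at most six colors is in particular one with colors below 6. *)
rewrite ltnNge; apply/negP => k6; case: (@torus_not_star_edge_colorable6 n).
have [c [ck c_star]] := k_col; exists c; split=> // e eE.
exact: leq_trans (ck e eE) k6.
Qed.
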